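(* Let $H$ be a nontrivial Puiseux monoid, and consider the following statements. (a) $H$ is strongly primary. (b) $0$ is not a limit point of $H \setminus \{0\}$. (c) $H$ is a BF-monoid. (d) $H$ satisfies the ascending chain condition on principal ideals. Then (a) implies (b), (b) implies (c), and (c) implies (d). Moreover, if $(H : \widehat H) \neq \emptyset$, then all four statements are equivalent.
   Context: A Puiseux monoid is a submonoid of $(\mathbb Q_{\ge 0}, +)$; it is nontrivial if it is not $\{0\}$. Let $H$ be a nontrivial Puiseux monoid and let $H^\bullet = H \setminus \{0\}$; $\mathbb N$ is the set of positive integers. $H$ is strongly primary if for each $a \in H^\bullet$ there is $n \in \mathbb N$ such that every sum of $n$ elements of $H^\bullet$ lies in $a + H$. An atom of $H$ is an element of $H^\bullet$ that is not a sum of two elements of $H^\bullet$. $H$ is a BF-monoid if for every $a \in H$ the set of lengths $\mathsf L(a)$, i.e. the set of all $k \in \mathbb N_0$ such that $a$ is a sum of $k$ atoms, is finite and non-empty. Principal ideals are the sets $x + H$ with $x \in H$. Writing $\mathsf q(H) \subset \mathbb Q$ for the quotient group of $H$, the complete integral closure is $\widehat H = \{x \in \mathsf q(H) : \text{there is } c \in H \text{ with } c + nx \in H \text{ for all } n \in \mathbb N\}$, and the conductor is $(H : \widehat H) = \{x \in \mathsf q(H) : x + \widehat H \subset H\}$. *)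

(* Defs.v *)
From mathcomp Require Import all_boot all_order all_algebra.
From mathcomp Require Import boolp classical_sets cardinality topology normedtype.

Set Implicit Arguments.
Unset Strict Implicit.
Unset Printing Implicit Defensive.

Import Order.TTheory GRing.Theory Num.Theory.
Import numFieldNormedType.Exports.

Local Open Scope ring_scope.
Local Open Scope classical_set_scope.

Record puiseux_monoid (H : set rat) : Prop := PuiseuxMonoid {
  puiseux_ge0 : forall x, H x -> 0 <= x;
  puiseux_0 : H 0;
  puiseux_add : forall x y, H x -> H y -> H (x + y)
}.

Definition nonzero (H : set rat) : set rat := H `\ 0.

Definition nontrivial (H : set rat) : Prop := H != [set 0].

Definition translate (x : rat) (A : set rat) : set rat := [set x + y | y in A].

Definition n_fold_sums (n : nat) (A : set rat) : set rat :=
  [set \sum_(i < n) x i | x in [set x : 'I_n -> rat | forall i, A (x i)]].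

Definition strongly_primary (H : set rat) : Prop :=
  forall a, nonzero H a ->
    exists n, (0 < n)%N /\ n_fold_sums n (nonzero H) `<=` translate a H.

(* [rat^o] carries the topology of the absolute value on [rat]; being a limit
   point of a subset of Q is the same in Q as in the real line. *)
Definition zero_not_limit_point (H : set rat) : Prop :=
  ~ limit_point (nonzero H : set rat^o) 0.

Definition atoms (H : set rat) : set rat :=
  [set a | nonzero H a /\
           ~ (exists b c, [/\ nonzero H b, nonzero H c & a = b + c])].

(* In particular [0] is the length of the empty factorization of [0]. *)
Definition lengths (H : set rat) (a : rat) : set nat :=
  [set k | n_fold_sums k (atoms H) a].

Definition BF_monoid (H : set rat) : Prop :=
  forall a, H a -> finite_set (lengths H a) /\ lengths H a !=set0.

Definition principal_ideal (H I : set rat) : Prop :=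
  exists2 x, H x & I = translate x H.

Definition ACCP (H : set rat) : Prop :=
  forall I : nat -> set rat,
    (forall n, principal_ideal H (I n)) ->
    (forall n, I n `<=` I n.+1) ->
    exists N, forall n, (N <= n)%N -> I n = I N.

Definition quotient_group (H : set rat) : set rat :=
  [set x - y | x in H & y in H].

Definition complete_integral_closure (H : set rat) : set rat :=
  [set x | quotient_group H x /\
           exists c, H c /\ forall n, (0 < n)%N -> H (c + x *+ n)].

Definition conductor (H : set rat) : set rat :=
  [set x | quotient_group H x /\
           translate x (complete_integral_closure H) `<=` H].

(* Main.v *)
Require Import Defs.
From mathcomp Require Import all_boot all_order all_algebra.
From mathcomp Require Import boolp classical_sets cardinality topology normedtype.
From mathcomp Require Import zify ring lra.

(** For the equivalence, the main point is that a Puiseux monoid [H] has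
    complete integral closure [{x in q(H) | x >= 0}]: if [x = p - q] with
    [p], [q] in [H] and [u * p = v * q] for positive integers [u <= v], then
    [u * q + n * x] lies in [H] for all [n].  Hence an element [f] of the
    conductor satisfies [f + x \in H] for all nonnegative [x] in [q(H)].  If
    [H \ {0}] is bounded below by [e > 0], then a sum [s] of [n] nonzero
    elements satisfies [s - a >= f] as soon as [n * e >= a + f], which gives
    (b) => (a).  If [0] is a limit point of [H \ {0}], choose [y_0 > 0] in [H]
    and [h_n] nonzero in [H] with [h_n < y_n] and put [y_(n+1) = y_n - h_n]:
    the ideals generated by the [f + y_n] form a strictly ascending chain, so
    (d) fails. *)

Import Order.TTheory GRing.Theory Num.Theory.
Import numFieldNormedType.Exports.

Local Open Scope ring_scope.
Local Open Scope classical_set_scope.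

Lemma n_fold_sums0 (A : set rat) : n_fold_sums 0 A 0.
Proof. by exists (fun=> 0); [case | rewrite big_ord0]. Qed.

Lemma n_fold_sums_const (A : set rat) n x : A x -> n_fold_sums n A (x *+ n).
Proof. by move=> Ax; exists (fun=> x) => //; rewrite sumr_const card_ord. Qed.

Lemma n_fold_sumsD (A : set rat) m n x y :
  n_fold_sums m A x -> n_fold_sums n A y -> n_fold_sums (m + n) A (x + y).
Proof.
move=> [f Af <-] [g Ag <-].
exists (fun i => match fintype.split i with inl j => f j | inr j => g j end).
  by move=> i; case: fintype.split.
rewrite big_split_ord /=; congr (_ + _); apply: eq_bigr => i _.
  by rewrite -[lshift n i]/(unsplit (inl i)) unsplitK.
by rewrite -[rshift m i]/(unsplit (inr i)) unsplitK.
Qed.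

Lemma n_fold_sums_ge (A : set rat) e n s :
  (forall x, A x -> e <= x) -> n_fold_sums n A s -> e *+ n <= s.
Proof.
move=> leA [f Af <-]; rewrite -[n in _ *+ n]card_ord -sumr_const.
by apply: ler_sum => i _; exact: leA.
Qed.

Lemma zero_not_limit_pointP (H : set rat) :
  puiseux_monoid H ->
  zero_not_limit_point H <->
  exists2 e, 0 < e & forall x, nonzero H x -> e <= x.
Proof.
move=> [H_ge0 _ _]; split.
  move=> Hlim; apply: contrapT => Hno; apply: Hlim => U.
  move=> /nbhs_ballP[e /= e_gt0 eU].
  have [x Hx x_lt] : exists2 x, nonzero H x & x < e.
    apply: contrapT => Hx; apply: Hno; exists e => // x Hx'.
    by rewrite leNgt; apply/negP => xe; apply: Hx; exists x.
  exists x; split => //; first by case: Hx => _ /eqP.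
  apply: eU; rewrite /ball /= sub0r normrN ger0_norm //.
  by case: Hx => /H_ge0.
move=> [e e_gt0 leH] /(_ (ball (0 : rat^o) e)).
case; first exact: nbhsx_ballx.
move=> y [_ Hy]; rewrite /ball /= sub0r normrN ltNge.
by rewrite (le_trans (leH _ Hy)) ?ler_norm.
Qed.

Lemma rat_natmul_ge (e a : rat) : 0 < e -> exists n, a <= e *+ n.
Proof.
move=> e_gt0; exists (Num.Def.archi_bound (a / e)).
rewrite -mulr_natr -ler_pdivrMl // mulrC.
have [a_ge0|/ltW] := leP 0 (a / e); first by rewrite ltW // archi_boundP.
by move=> /le_trans; apply; rewrite ler0n.
Qed.

Section PuiseuxMonoid.

Variables (H : set rat) (H_puiseux : puiseux_monoid H).

Let H_ge0 : forall x, H x -> 0 <= x. Proof. by case: H_puiseux. Qed.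
Let H_0 : H 0. Proof. by case: H_puiseux. Qed.
Let H_add : forall x y, H x -> H y -> H (x + y). Proof. by case: H_puiseux. Qed.

Lemma nonzero_gt0 x : nonzero H x -> 0 < x.
Proof. by move=> [Hx /eqP x0]; rewrite lt_def x0 H_ge0. Qed.

Lemma puiseux_mulrn x n : H x -> H (x *+ n).
Proof. by move=> Hx; elim: n => // n IHn; rewrite mulrS; apply: H_add. Qed.

(** If every sum of [n] nonzero elements lies in [a + H], then so does [x *+ n] for each nonzero
    [x]; hence [a / n] bounds the nonzero elements from below. *)
Lemma strongly_primary_zero_not_limit_point :
  nontrivial H -> strongly_primary H -> zero_not_limit_point H.
Proof.
move=> nt prim; apply/zero_not_limit_pointP => //.
have [a Ha] : exists a, nonzero H a.
  apply: contrapT => Hno; case/eqP: nt; apply/seteqP; split=> x /=.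
    by move=> Hx; apply: contrapT => x0; apply: Hno; exists x.
  by move=> ->.
have a_gt0 := nonzero_gt0 _ Ha.
have [n [n_gt0 sub]] := prim a Ha.
exists (a / n%:R) => [|x Hx]; first by rewrite divr_gt0 ?ltr0n.
have [y Hy] := sub _ (n_fold_sums_const _ n x Hx).
rewrite ler_pdivrMr ?ltr0n // mulr_natr => <-.
by rewrite lerDl H_ge0.
Qed.

(** Induction on [n] with [a <= e *+ n]: if a nonzero [a] is not an atom, each of its two nonzero
    summands is at least [e], so the other one satisfies the bound for the preceding [n]. *)
Lemma lengths_nonempty e a :
  0 < e -> (forall x, nonzero H x -> e <= x) -> H a -> lengths H a !=set0.
Proof.
move=> e_gt0 leH; have [n] := rat_natmul_ge e a e_gt0.
elim: n a => [|n IHn] a.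
  rewrite mulr0n => a_le0 Ha.
  have -> : a = 0 by apply/eqP; rewrite eq_le a_le0 H_ge0.
  by exists 0%N; exact: n_fold_sums0.
move=> a_le Ha; have [->|/eqP a_neq0] := eqVneq a 0.
  by exists 0%N; exact: n_fold_sums0.
have [[b [c [Hb Hc aE]]]|a_irr] :=
    pselect (exists b c, [/\ nonzero H b, nonzero H c & a = b + c]).
  have [leb lec] := (leH _ Hb, leH _ Hc).
  move: a_le; rewrite mulrSr => a_le.
  have [k kb] : lengths H b !=set0 by apply: IHn (proj1 Hb); lra.
  have [l lc] : lengths H c !=set0 by apply: IHn (proj1 Hc); lra.
  by exists (k + l)%N; rewrite aE; apply: n_fold_sumsD.
by exists 1%N; rewrite -[a]mulr1n; apply: n_fold_sums_const.
Qed.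

Lemma zero_not_limit_point_BF : zero_not_limit_point H -> BF_monoid H.
Proof.
move=> /(zero_not_limit_pointP _ H_puiseux)[e e_gt0 leH] a Ha.
split; last exact: (lengths_nonempty e).
have [n a_le] := rat_natmul_ge e a e_gt0.
apply: (sub_finite_set _ (finite_II n.+1)) => k /= Lk.
(* Atoms are nonzero, hence at least [e]; this forces [k <= n] for every length [k] of [a]. *)
have ek : e *+ k <= a by apply: n_fold_sums_ge Lk => x [Hx _]; apply: leH.
by rewrite ltnS -(ler_pMn2l e_gt0) (le_trans ek).
Qed.

Lemma translate_sub x y : H (x - y) -> translate x H `<=` translate y H.
Proof.
move=> Hxy _ [h Hh <-]; exists (x - y + h); first exact: H_add.
by rewrite addrA subrKC.
Qed.

Lemma translate_sub_self x y : translate x H `<=` translate y H -> H (x - y).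
Proof.
move=> /(_ x)[]; first by exists 0 => //; rewrite addr0.
by move=> h Hh <-; rewrite addrC addKr.
Qed.

(** The nonzero element [x - y] has a factorization of positive length; joined to one of [y], it
    gives a strictly longer factorization of [x]. *)
Lemma lengths_lt x y k : BF_monoid H -> H (x - y) -> x != y ->
  (forall l, lengths H x l -> (l < k.+1)%N) ->
  forall l, lengths H y l -> (l < k)%N.
Proof.
move=> BF Hh x_neq_y ltk l Ll.
have [_ [[|m] Lm]] := BF _ Hh.
  case: Lm => f _; rewrite big_ord0 => /esym/eqP.
  by rewrite subr_eq0 (negPf x_neq_y).
have /ltk : lengths H x (m.+1 + l).
  by rewrite -(subrK y x); apply: n_fold_sumsD.
by lia.
Qed.

Lemma BF_ACCP : BF_monoid H -> ACCP H.
Proof.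
move=> BF I prI leI.
have {}leI m n : (m <= n)%N -> I m `<=` I n.
  elim: n => [|n IHn]; first by rewrite leqn0 => /eqP ->.
  by rewrite leq_eqVlt => /predU1P[->//|/IHn/subset_trans]; apply.
(* Induction on a strict bound [k] for the lengths of a generator of [I m]: unless the chain is
   constant from [m] on, a later, different ideal has a generator with bound [k - 1]. The bound 0 is
   impossible because sets of lengths are non-empty. *)
suff stab k m x : H x -> I m = translate x H ->
    (forall l, lengths H x l -> (l < k)%N) ->
    exists N, forall n, (N <= n)%N -> I n = I N.
  have [x Hx I0] := prI 0%N; have [fin _] := BF _ Hx.
  have [k ltk] : exists k, forall l, lengths H x l -> (l < k)%N.
    have /finite_seqP[s sE] := fin; exists (\max_(l <- s) l).+1 => l.
    by rewrite sE ltnS => ls; exact: (@leq_bigmax_seq _ s xpredT id l).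
  exact: (stab k 0%N x).
elim: k m x => [|k IHk] m x Hx Im ltk.
  by have [_ [l /ltk]] := BF _ Hx.
have [[n [le_mn neI]]|Hno] :=
    pselect (exists n, (m <= n)%N /\ I n <> I m); last first.
  by exists m => n le_mn; apply: contrapT => neI; apply: Hno; exists n.
have [y Hy In] := prI n.
apply: (IHk n y Hy In); apply: lengths_lt ltk => //.
  by apply: translate_sub_self; rewrite -Im -In; exact: leI.
by apply/eqP => xy; apply: neI; rewrite In Im xy.
Qed.

Lemma complete_integral_closure_ge0 x :
  quotient_group H x -> 0 <= x -> complete_integral_closure H x.
Proof.
move=> Qx x_ge0; split=> //; case: Qx => p Hp [q Hq xE].
(* For [q = 0], [x = p] lies in [H] and [c = 0] works; otherwise [v / u] is the reduced form of
   [p / q]. *)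
have [q_eq0|q_neq0] := eqVneq q 0.
  exists 0; split=> // n _; rewrite add0r; apply: puiseux_mulrn.
  by rewrite -xE q_eq0 subr0.
have q_gt0 : 0 < q by rewrite lt_def q_neq0 H_ge0.
have [u [v [u_gt0 le_uv upE]]] :
    exists u v, [/\ (0 < u)%N, (u <= v)%N & p *+ u = q *+ v].
  have p_ge : q <= p by rewrite -subr_ge0 xE.
  have r_ge0 : 0 <= p / q by rewrite divr_ge0 // H_ge0.
  have pqE : p *+ `|denq (p / q)|%N = q *+ `|numq (p / q)|%N.
    rewrite !pmulrn absz_denq gez0_abs ?numq_ge0 // -mulrzr -[RHS]mulrzr numqE.
    by field.
  exists `|denq (p / q)|%N, `|numq (p / q)|%N; split => //.
    by rewrite absz_gt0 denq_neq0.
  by rewrite -(ler_pMn2l q_gt0) -pqE lerMn2r p_ge orbT.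
exists (q *+ u); split=> [|n _]; first exact: puiseux_mulrn.
have lt_r : (n %% u < u)%N by rewrite ltn_mod.
(* Divide [n] by [u]: each full block of [u] copies of [p - q] equals [q *+ (v - u)], and the added
   [q *+ u] absorbs the fewer than [u] remaining copies of [- q]. *)
have -> : q *+ u + x *+ n =
    q *+ (n %/ u * (v - u)) + p *+ (n %% u) + q *+ (u - n %% u).
  rewrite {1}(divn_eq n u) -xE mulrnBl !mulrnDr.
  rewrite mulnC [p *+ (u * _)]mulrnA upE -mulrnA mulnBr.
  rewrite !mulrnBr ?leq_mul2l ?le_uv ?orbT // 1?ltnW //.
  by rewrite [(u * _)%N]mulnC [(v * _)%N]mulnC; ring.
by do 2?apply: H_add; apply: puiseux_mulrn.
Qed.

Lemma conductorP f : conductor H f ->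
  H f /\ forall x, quotient_group H x -> 0 <= x -> H (f + x).
Proof.
move=> [_ sub]; have Hf x : quotient_group H x -> 0 <= x -> H (f + x).
  move=> Qx x_ge0; apply: sub; exists x => //.
  exact: complete_integral_closure_ge0.
split=> //; rewrite -[f]addr0; apply: Hf => //.
by exists 0 => //; exists 0 => //; rewrite subr0.
Qed.

Lemma zero_not_limit_point_strongly_primary :
  conductor H !=set0 -> zero_not_limit_point H -> strongly_primary H.
Proof.
move=> [f /conductorP[Hf cond]].
move=> /(zero_not_limit_pointP _ H_puiseux)[e e_gt0 leH].
move=> a [Ha _]; have [n le_n] := rat_natmul_ge e (a + f) e_gt0.
(* The successor only ensures a positive number of summands. *)
exists n.+1; split=> // s Ss.
have les := n_fold_sums_ge _ _ _ _ leH Ss.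
have Hs : H s.
  case: Ss => g Ag <-; elim/big_ind: _ => // i _.
  by have [] := Ag i.
exists (s - a); last by rewrite subrKC.
have -> : s - a = f + (s - (a + f)) by ring.
apply: cond.
  by exists s => //; exists (a + f) => //; exact: H_add.
by move: les; rewrite mulrSr; lra.
Qed.

Lemma ACCP_zero_not_limit_point :
  conductor H !=set0 -> ACCP H -> zero_not_limit_point H.
Proof.
move=> [f /conductorP[Hf cond]] accp; apply/zero_not_limit_pointP => //.
apply: contrapT => Hno.
(* The implication is placed under the existential so that choice yields a total function [g]; for
   [y <= 0] the witness 0 is a dummy. *)
have small y : exists h, 0 < y -> nonzero H h /\ h < y.
  have [y_gt0|] := boolP (0 < y); last by exists 0.
  apply: contrapT => Hh; apply: Hno; exists y => // x Hx.
  by rewrite leNgt; apply/negP => xy; apply: Hh; exists x.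
have [g gP] := choice small.
have [y0 [Hy0 _] y0_gt0] : exists2 y, nonzero H y & 0 < y.
  by exists (g 1); have [] := gP 1 ltr01 => // /nonzero_gt0.
pose y n := iter n (fun z => z - g z) y0.
have yP n : quotient_group H (y n) /\ 0 < y n.
  elim: n => [|n [[p Hp [q Hq yE]] y_gt0]].
    by split=> //; exists y0 => //; exists 0 => //; rewrite subr0.
  have [[Hg _] ltg] := gP _ y_gt0; split; last by rewrite /= subr_gt0.
  exists p => //; exists (q + g (y n)); first exact: H_add.
  by rewrite /= -/(y n) -yE opprD addrA.
have yS n : y n.+1 = y n - g (y n) by [].
have [|n|N] := accp (fun n => translate (f + y n) H).
- by move=> n; exists (f + y n) => //; have [Qy /ltW] := yP n; apply: cond.
- apply: translate_sub; rewrite yS.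
  have -> : f + y n - (f + (y n - g (y n))) = g (y n) by ring.
  by have [_ /gP[[]]] := yP n.
(* Equality of the ideals at [N] and [N.+1] would put [y N.+1 - y N = - g (y N)], a negative number,
   into [H]. *)
move=> /(_ N.+1 (leqnSn N)) eqI.
have := H_ge0 _ (translate_sub_self (f + y N.+1) (f + y N) _).
rewrite eqI yS => /(_ (@subset_refl _ _)).
by have [_ /gP[/nonzero_gt0]] := yP N; lra.
Qed.

End PuiseuxMonoid.

Theorem theorem3p4 (H : set rat) (H_puiseux : puiseux_monoid H)
    (H_nontrivial : nontrivial H) :
  [/\ strongly_primary H -> zero_not_limit_point H,
      zero_not_limit_point H -> BF_monoid H,
      BF_monoid H -> ACCP H
    & conductor H !=set0 ->
      [<-> strongly_primary H; zero_not_limit_point H; BF_monoid H; ACCP H]].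
Proof.
have ab := strongly_primary_zero_not_limit_point _ H_puiseux H_nontrivial.
have bc := zero_not_limit_point_BF _ H_puiseux.
have cd := BF_ACCP _ H_puiseux.
(* Only (d) => (a) remains to close the cycle; it passes through (b). *)
split=> // cond; tfae=> // accp.
apply: zero_not_limit_point_strongly_primary => //.
exact: ACCP_zero_not_limit_point.
Qed.
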